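(* Let $d\in\mathbb N$ and let $A$ be a real $d\times d$ diagonalizable matrix with positive eigenvalues. Let $F:[0,\infty)\times\mathbb R^d\to\mathbb R^d$, $(t,x)\mapsto F(t,x)$, be continuous, locally Lipschitz with respect to $x$ in $[0,\infty)\times\mathbb R^d$, and suppose there exist positive numbers $c_*,\varepsilon_*,\alpha$ such that $$|F(t,x)|\le c_*|x|^{1+\alpha}\quad\text{for all }t\ge0\text{ and all }x\in\mathbb R^d\text{ with }|x|\le\varepsilon_*.$$ Let $y\in C^1([0,\infty),\mathbb R^d)$ be a solution of $\frac{\mathrm dy}{\mathrm dt}+Ay=F(t,y)$ for $t>0$, with $y(0)\ne0$ and $\lim_{t\to\infty}y(t)=0$. Then there exist an eigenvalue $\lambda_*$ of $A$ and a corresponding eigenvector $\xi_*$ such that $$|y(t)-e^{-\lambda_*t}\xi_*|=\mathcal O(e^{-(\lambda_*+\delta)t})\quad\text{for some }\delta>0.$$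
   Context: $|\cdot|$ is the Euclidean norm on $\mathbb R^d$. For functions of $t$, $f(t)=\mathcal O(h(t))$ means that there are $T$ and $C>0$ with $|f(t)|\le Ch(t)$ for all $t\ge T$. Eigenvectors are nonzero vectors in $\mathbb R^d$. *)

(* Defs.v *)
From HB Require Import structures.
From mathcomp Require Export all_boot all_order all_algebra.
From mathcomp Require Export all_classical all_reals all_analysis.

Set Implicit Arguments.
Unset Strict Implicit.
Unset Printing Implicit Defensive.

Import Order.TTheory GRing.Theory Num.Theory.
Import numFieldNormedType.Exports.

Local Open Scope classical_set_scope.
Local Open Scope ring_scope.

(* The library norm on matrices is the sup norm; it induces the usual topology,
   but quantitative bounds below refer to the Euclidean norm. *)
Definition enorm (R : realType) (d : nat) (x : 'cV[R]_d) : R :=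
  Num.sqrt (\sum_(i < d) x i ord0 ^+ 2).

(* Functions on [0, +oo[ are represented by functions on R; the definitions
   below never look at their values at negative times. *)

Definition continuous_on_halfline (R : realType) (d : nat)
    (F : R -> 'cV[R]_d -> 'cV[R]_d) : Prop :=
  {within [set p : R * 'cV[R]_d | 0 <= p.1],
    continuous (fun p : R * 'cV[R]_d => F p.1 p.2)}.

(* The Lipschitz constant is uniform for (t, x) near each (t0, x0). *)
Definition locally_lipschitz_in_x (R : realType) (d : nat)
    (F : R -> 'cV[R]_d -> 'cV[R]_d) : Prop :=
  forall (t0 : R) (x0 : 'cV[R]_d), 0 <= t0 ->
  exists r L : R, [/\ 0 < r, 0 <= L &
    forall (t : R) (x1 x2 : 'cV[R]_d),
      0 <= t -> `|t - t0| < r -> enorm (x1 - x0) < r -> enorm (x2 - x0) < r ->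
      enorm (F t x1 - F t x2) <= L * enorm (x1 - x2)].

(* The derivative at 0 is one-sided: the difference quotient is taken along
   s -> t with s <> t and s >= 0. *)
Definition C1_halfline (R : realType) (d : nat) (y : R -> 'cV[R]_d) : Prop :=
  exists g : R -> 'cV[R]_d,
    {within [set t : R | 0 <= t], continuous g} /\
    forall t : R, 0 <= t ->
      (s - t)^-1 *: (y s - y t) @[s --> within [set s : R | 0 <= s] t^'] --> g t.

(* f(t) = O(h(t)) as t -> +oo *)
Definition bigO_pinfty (R : realType) (f h : R -> R) : Prop :=
  exists T C : R, 0 < C /\ forall t : R, T <= t -> `|f t| <= C * h t.

(* [eigenvalue] in mxalgebra is phrased with row vectors; a square matrix has
   the same eigenvalues on either side, but eigenvectors differ, so those are
   spelled out for the column action x |-> A *m x. *)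
Definition is_eigenvector (R : realType) (d : nat) (A : 'M[R]_d) (lambda : R)
    (xi : 'cV[R]_d) : Prop :=
  xi <> 0 /\ A *m xi = lambda *: xi.

(* Main.v *)
Require Import Defs.
From mathcomp Require Import ring lra.
Set Implicit Arguments.
Unset Strict Implicit.
Unset Printing Implicit Defensive.

Import Order.TTheory GRing.Theory Num.Theory.
Import numFieldNormedType.Exports.

Local Open Scope classical_set_scope.
Local Open Scope ring_scope.

(** Diagonalize A by P and follow z = P y, so that each coordinate solves
    z_i' = - lam_i z_i + G_i with |G| = O(|z|^(1 + alpha)), every lam_i > 0.

    The proof is a bootstrap on the rate a in |z| = O(e^(-a t)).  If such a
    bound holds, then G = O(e^(-(1 + alpha) a t)), and solving each scalar
    equation ([scalar_asymptotics]) gives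
      z_i = x_i e^(-lam_i t) + O(e^(-b t)),   b = (1 + alpha / 2) a.
    Now there are two cases ([leading_mode_of_modes]).  If some x_i with
    lam_i < b is nonzero, the smallest such lam_i dominates everything else,
    which is the expected expansion of z.  Otherwise every mode is absorbed in
    the error and |z| = O(e^(-b t)): the rate has been improved by the fixed
    factor 1 + alpha / 2.

    The improvement can be started, and cannot go on forever.  It starts
    because z tends to 0, so that the nonlinearity is eventually a small
    perturbation of the dissipative linear part and |z|^2 satisfies a
    differential inequality forcing some exponential decay
    ([enorm_upper_bound]).  It stops because |y'| <= K |y| along the solution,
    whence |y| >= c e^(-r t) with c > 0 by the same kind of inequality read in
    the other direction ([enorm_lower_bound]).  Hence the first alternative occurs after finitely many steps
    ([diagonal_leading_mode]), and P^-1 carries the leading mode of z to an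
    eigenvector of A. *)

(** * Monotonicity and exponential tails *)

Lemma is_derive_ge0_homo (R : realType) (f f' : R -> R) (a : R) :
  (forall t, a < t -> is_derive t 1 f (f' t)) ->
  (forall t, a < t -> 0 <= f' t) ->
  forall s t, a < s -> s <= t -> f s <= f t.
Proof.
move=> df f'0 s t as_ st.
have gt_a u : u \in `[s, t] -> a < u.
  by rewrite in_itv/= => /andP[su _]; exact: lt_le_trans su.
have df_oo u : u \in `]s, t[ -> is_derive u 1 f (f' u).
  by rewrite in_itv/= => /andP[/ltW su _]; apply: df; exact: lt_le_trans su.
have fcont : {within `[s, t], continuous f}.
  apply: derivable_within_continuous => u /gt_a au.
  by have [] := df _ au.
have [c /gt_a ac fst] := MVT_segment st df_oo fcont.
by rewrite -subr_ge0 fst mulr_ge0 ?subr_ge0 ?f'0.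
Qed.

Lemma is_derive_le0_homo (R : realType) (f f' : R -> R) (a : R) :
  (forall t, a < t -> is_derive t 1 f (f' t)) ->
  (forall t, a < t -> f' t <= 0) ->
  forall s t, a < s -> s <= t -> f t <= f s.
Proof.
move=> df f'0 s t as_ st; rewrite -lerN2.
apply: (@is_derive_ge0_homo _ (fun u => - f u) (fun u => - f' u) a) => // u au.
  by have := df _ au => ?; apply: is_deriveN.
by rewrite oppr_ge0 f'0.
Qed.

Lemma is_derive_expRM (R : realType) (a t : R) :
  is_derive t 1 (fun s => expR (a * s)) (a * expR (a * t)).
Proof.
rewrite mulrC; apply: (@is_derive1_comp R expR (fun s => a * s)).
have := @is_deriveZ _ _ _ id a t 1 1 (is_derive_id t 1).
by rewrite /GRing.scale/= mulr1.
Qed.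

(** The integrating factor: with a suitable [a], the derivative on the right
    no longer contains the linear term of an equation or inequality for [f]. *)
Lemma is_derive_mul_expR (R : realType) (f : R -> R) (df a t : R) :
  is_derive t 1 f df ->
  is_derive t 1 (fun s => f s * expR (a * s)) ((df + a * f t) * expR (a * t)).
Proof.
move=> fdf; have de := is_derive_expRM a t.
apply: is_derive_eq => /=; rewrite /GRing.scale/=; ring.
Qed.

(** Adding or subtracting a primitive of the bound C e^(-gam t) on |w'| turns
    [w] into a monotone function.  This replaces integration of w', and works
    for both signs of [gam]. *)
Lemma add_exp_tail_nincr (R : realType)
    (w w' : R -> R) (C gam T : R) :
  (forall t, T < t -> is_derive t 1 w (w' t)) -> gam != 0 ->
  (forall t, T < t -> `|w' t| <= C * expR (- gam * t)) ->
  forall s t, T < s -> s <= t ->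
  w t + C / gam * expR (- gam * t) <= w s + C / gam * expR (- gam * s).
Proof.
move=> dw gam_neq0 w'_le s t.
apply: (@is_derive_le0_homo _ (fun u => w u + C / gam * expR (- gam * u))
   (fun u => w' u - C * expR (- gam * u)) T) => u Tu.
  have dwu := dw _ Tu; have de := is_derive_expRM (- gam) u.
  apply: is_derive_eq; rewrite /GRing.scale/=; by field.
by have := w'_le _ Tu; rewrite ler_norml subr_le0 => /andP[].
Qed.

Lemma sub_exp_tail_ndecr (R : realType)
    (w w' : R -> R) (C gam T : R) :
  (forall t, T < t -> is_derive t 1 w (w' t)) -> gam != 0 ->
  (forall t, T < t -> `|w' t| <= C * expR (- gam * t)) ->
  forall s t, T < s -> s <= t ->
  w s - C / gam * expR (- gam * s) <= w t - C / gam * expR (- gam * t).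
Proof.
move=> dw gam_neq0 w'_le s t.
apply: (@is_derive_ge0_homo _ (fun u => w u - C / gam * expR (- gam * u))
   (fun u => w' u + C * expR (- gam * u)) T) => u Tu.
  have dwu := dw _ Tu; have de := is_derive_expRM (- gam) u.
  apply: is_derive_eq; rewrite /GRing.scale/=; by field.
by have := w'_le _ Tu; rewrite ler_norml -subr_ge0 opprK => /andP[].
Qed.

(** The two monotone functions of the preceding lemmas enclose [w], and every
    value of the lower one is at most every value of the upper one.  A number
    between them all is the limit of [w], at a distance from [w t] which is at
    most the width of the enclosure. *)
Lemma exp_tail_cvg (R : realType)
    (w w' : R -> R) (C gam T : R) :
  (forall t, T < t -> is_derive t 1 w (w' t)) -> 0 < gam ->
  (forall t, T < t -> `|w' t| <= C * expR (- gam * t)) ->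
  exists xi, forall t, T < t -> `|w t - xi| <= C / gam * expR (- gam * t).
Proof.
move=> dw gam0 w'_le; have gam_neq0 := lt0r_neq0 gam0.
pose u t := w t + C / gam * expR (- gam * t).
pose l t := w t - C / gam * expR (- gam * t).
have C0 t : T < t -> 0 <= C / gam * expR (- gam * t).
  move=> /w'_le /(le_trans (normr_ge0 _)) h.
  by rewrite -mulrA mulrCA mulr_ge0 // invr_ge0 ltW.
have lu s t : T < s -> T < t -> l s <= u t.
  move=> Ts Tt; case: (leP s t) => [st|/ltW ts].
    apply: (le_trans (sub_exp_tail_ndecr dw gam_neq0 w'_le Ts st)).
    have := C0 _ Tt; rewrite /u; lra.
  apply: le_trans (add_exp_tail_nincr dw gam_neq0 w'_le Tt ts).
  have := C0 _ Ts; rewrite /l; lra.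
pose S := [set x | exists2 t, T < t & x = l t].
have S0 : S !=set0 by exists (l (T + 1)), (T + 1) => //; lra.
have Sub t : T < t -> ubound S (u t) by move=> Tt _ [s Ts ->]; exact: lu.
exists (sup S) => t Tt.
have h1 : sup S <= u t by apply: ge_sup => //; exact: Sub.
have h2 : l t <= sup S.
  by apply: ub_le_sup; [exists (u t); exact: Sub|exists t].
by rewrite ler_norml; move: h1 h2; rewrite /u /l; lra.
Qed.

(** * Exponential rates *)

Definition expO (R : realType) (a : R) (f : R -> R) : Prop :=
  bigO_pinfty f (fun t => expR (- a * t)).

(** Thresholds can be moved beyond any prescribed time, and beyond 0, which is
    what comparing exponentials of different rates requires. *)
Lemma expO_after (R : realType) (a T0 : R) (f : R -> R) : expO a f ->
  exists T C, [/\ T0 < T, 0 < T, 0 < C &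
    forall t, T < t -> `|f t| <= C * expR (- a * t)].
Proof.
move=> [T [C [C0 fC]]]; exists (Num.max T (Num.max T0 0) + 1), C; split=> //.
- by rewrite ltr_pwDr// 2!le_max lexx orbT.
- by rewrite ltr_pwDr// 2!le_max lexx !orbT.
- move=> t Tt; apply: fC; apply: le_trans (ltW Tt).
  by rewrite -[leLHS]addr0 lerD// le_max lexx.
Qed.

Lemma expO_near (R : realType) (a C : R) (f : R -> R) :
  (\forall t \near +oo, `|f t| <= C * expR (- a * t)) -> expO a f.
Proof.
move=> [T [_ fC]]; exists (T + 1), (`|C| + 1); split; first by rewrite ltr_wpDl.
move=> t Tt; apply: le_trans (fC t _) _.
  by apply: lt_le_trans Tt; rewrite ltrDl.
by rewrite ler_pM2r ?expR_gt0// ler_wpDr// ler_norm.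
Qed.

Lemma expO_le_near (R : realType) (a C : R) (f g : R -> R) :
  (\forall t \near +oo, `|f t| <= C * `|g t|) -> expO a g -> expO a f.
Proof.
move=> [T [_ fg]] /(expO_after T)[T' [C' [TT' T'0 C'0 gC']]].
exists (T' + 1), ((`|C| + 1) * C'); split.
  by rewrite mulr_gt0// ltr_wpDl.
move=> t T't; have T't' : T' < t by apply: lt_le_trans T't; rewrite ltrDl.
apply: le_trans (fg t (lt_trans TT' T't')) _; rewrite -mulrA.
apply: le_trans (_ : (`|C| + 1) * `|g t| <= _).
  by apply: ler_wpM2r => //; rewrite ler_wpDr// ler_norm.
by apply: ler_wpM2l; [rewrite addr_ge0|exact: gC'].
Qed.

Lemma expOD (R : realType) (a : R) (f g : R -> R) :
  expO a f -> expO a g -> expO a (fun t => f t + g t).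
Proof.
move=> [T [C [C0 fC]]] /(expO_after T)[T' [C' [TT' _ C'0 gC']]].
apply: (@expO_near _ _ (C + C')); exists T'; split; first exact: num_real.
move=> t T't; apply: le_trans (ler_normD _ _) _; rewrite mulrDl lerD ?gC'//.
by rewrite fC// ltW// (lt_trans TT').
Qed.

Lemma expO0 (R : realType) (a : R) (f : R -> R) : f =1 (fun=> 0) -> expO a f.
Proof.
move=> f0; exists 0, 1; split => // t _.
by rewrite f0 normr0 mul1r expR_ge0.
Qed.

Lemma expO_sum (R : realType) (a : R) (n : nat) (f : 'I_n -> R -> R) :
  (forall i, expO a (f i)) -> expO a (fun t => \sum_(i < n) f i t).
Proof.
move=> fO; rewrite -(_ : \sum_(i < n) f i = fun t => \sum_(i < n) f i t).
  apply: (big_ind (expO a)) => //; first exact: expO0.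
  by move=> g h gO hO; exact: expOD.
by apply/funext => t; rewrite fct_sumE.
Qed.

Lemma expO_expR (R : realType) (a b c : R) : a <= b ->
  expO a (fun t => c * expR (- b * t)).
Proof.
move=> ab; apply: (@expO_near _ _ `|c|); exists 0; split => // t t0.
rewrite normrM (ger0_norm (expR_ge0 _)) ler_wpM2l// ler_expR.
by rewrite ler_wpM2r ?lerN2// ltW.
Qed.

Lemma expO_weaken (R : realType) (a b : R) (f : R -> R) : a <= b ->
  expO b f -> expO a f.
Proof.
move=> ab /(expO_after 0)[T [C [_ T0 C0 fC]]].
apply: (@expO_near _ _ C); exists T; split; first exact: num_real.
move=> t Tt; apply: (le_trans (fC t Tt)); rewrite ler_pM2l// ler_expR.
by rewrite ler_wpM2r ?lerN2// ltW// (lt_trans T0).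
Qed.

(** Put w = z e^(lam t), so that w' = O(e^((lam - beta) t)).  If lam < beta,
    then [w] converges at an exponential rate and [xi] is its limit.  If
    beta <= lam, then [w] may grow, but no faster than e^((lam - b) t), so that
    [z] itself is O(e^(-b t)) and [xi] = 0 does.  The loss from [beta] to [b]
    avoids the resonant case lam = beta, where a factor t would appear. *)
Lemma scalar_asymptotics (R : realType) (lam beta b T : R) (z g : R -> R) :
  b < beta -> (forall t, T < t -> is_derive t 1 z (- lam * z t + g t)) ->
  expO beta g ->
  exists xi, expO b (fun t => z t - xi * expR (- lam * t)).
Proof.
move=> bbeta dz /(expO_after T)[S [C [TS S0 C0 gC]]].
pose w t := z t * expR (lam * t).
have dw t : S < t -> is_derive t 1 w (g t * expR (lam * t)).
  move=> St; have dzt := dz _ (lt_trans TS St).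
  by apply: (is_derive_eq (is_derive_mul_expR lam dzt)); ring.
have zw t : z t = w t * expR (- lam * t).
  by rewrite /w -mulrA -expRD mulNr subrr expR0 mulr1.
have [lb|bl] := ltP lam beta.
  have gam0 : 0 < beta - lam by rewrite subr_gt0.
  have w'C t : S < t ->
      `|g t * expR (lam * t)| <= C * expR (- (beta - lam) * t).
    move=> St; rewrite normrM (ger0_norm (expR_ge0 _)).
    rewrite (_ : - (beta - lam) * t = - beta * t + lam * t); last by ring.
    by rewrite expRD mulrA ler_pM2r ?expR_gt0// gC.
  have [xi wxi] := exp_tail_cvg dw gam0 w'C.
  exists xi.
  apply: (expO_weaken (ltW bbeta)).
  apply: (@expO_near _ _ (C / (beta - lam))); exists S.
  split; first exact: num_real.
  move=> t St; rewrite zw -mulrBl normrM (ger0_norm (expR_ge0 _)).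
  rewrite (_ : - beta * t = - (beta - lam) * t + - lam * t); last by ring.
  by rewrite expRD mulrA ler_pM2r ?expR_gt0// wxi.
exists 0.
have kap0 : 0 < lam - b by rewrite subr_gt0 (lt_le_trans bbeta).
have gam0 : b - lam != 0 by rewrite lt_eqF// -oppr_gt0 opprB.
have w'C t : S < t -> `|g t * expR (lam * t)| <= C * expR (- (b - lam) * t).
  move=> St; rewrite normrM (ger0_norm (expR_ge0 _)).
  rewrite (_ : - (b - lam) * t = - b * t + lam * t); last by ring.
  rewrite expRD mulrA ler_pM2r ?expR_gt0// (le_trans (gC _ St))//.
  rewrite ler_pM2l// ler_expR ler_wpM2r ?lerN2 ?(ltW bbeta)//.
  by rewrite ltW// (lt_trans S0).
pose s := S + 1; have Ss : S < s by rewrite ltrDl.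
pose M := C / (b - lam); pose E t := expR (- (b - lam) * t).
have M0 : M <= 0 by rewrite /M pmulr_rle0// invr_le0 -oppr_ge0 opprB ltW.
apply: (@expO_near _ _ (`|w s| - M)); exists s; split; first exact: num_real.
move=> t st.
have up : w t + M * E t <= w s + M * E s :=
  add_exp_tail_nincr dw gam0 w'C Ss (ltW st).
have dn : w s - M * E s <= w t - M * E t :=
  sub_exp_tail_ndecr dw gam0 w'C Ss (ltW st).
have MEs : M * E s <= 0 by rewrite mulr_le0_ge0 ?expR_ge0.
have Et : 1 <= E t.
  rewrite -expR0 ler_expR opprB mulr_ge0 ?ltW// (lt_trans S0)//.
  exact: lt_trans Ss st.
have wt : `|w t| <= (`|w s| - M) * E t.
  have : `|w s| <= `|w s| * E t by rewrite ler_peMr.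
  have := ler_norm (w s); have := ler_norm (- w s); rewrite normrN => h1 h2 h3.
  by rewrite ler_norml mulrBl; move: (M * E t) (M * E s) up dn MEs => *; lra.
rewrite mul0r subr0 zw normrM (ger0_norm (expR_ge0 _)).
rewrite (_ : - b * t = - (b - lam) * t + - lam * t); last by ring.
by rewrite expRD mulrA ler_pM2r ?expR_gt0.
Qed.

(** * Energy estimates for the Euclidean norm *)

Lemma enorm_ge0 (R : realType) (d : nat) (x : 'cV[R]_d) : 0 <= enorm x.
Proof. exact: sqrtr_ge0. Qed.

Lemma enorm_sqr (R : realType) (d : nat) (x : 'cV[R]_d) :
  enorm x ^+ 2 = \sum_(i < d) x i ord0 ^+ 2.
Proof. by rewrite sqr_sqrtr// sumr_ge0// => i _; rewrite sqr_ge0. Qed.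

Lemma coord_le_enorm (R : realType) (d : nat) (x : 'cV[R]_d) (i : 'I_d) :
  `|x i ord0| <= enorm x.
Proof.
rewrite -sqrtr_sqr ler_wsqrtr// (bigD1 i)//= lerDl sumr_ge0// => j _.
exact: sqr_ge0.
Qed.

Lemma enorm_le_sum (R : realType) (d : nat) (x : 'cV[R]_d) :
  enorm x <= \sum_(i < d) `|x i ord0|.
Proof.
have S0 : 0 <= \sum_(i < d) `|x i ord0| by rewrite sumr_ge0.
rewrite -(ler_pXn2r (ltn0Sn 1)) ?nnegrE ?enorm_ge0// enorm_sqr expr2 mulr_suml.
apply: ler_sum => i _; rewrite -real_normK ?num_real// expr2 ler_wpM2l//.
by rewrite (bigD1 i)//= lerDl sumr_ge0.
Qed.

Lemma enorm_mulmx (R : realType) (m n : nat) (M : 'M[R]_(m, n)) :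
  exists2 C, 0 < C & forall x : 'cV[R]_n, enorm (M *m x) <= C * enorm x.
Proof.
exists (\sum_i \sum_j `|M i j| + 1).
  by rewrite ltr_wpDl// sumr_ge0// => i _; rewrite sumr_ge0.
move=> x; apply: le_trans (enorm_le_sum _) _.
apply: le_trans (_ : (\sum_i \sum_j `|M i j|) * enorm x <= _); last first.
  by rewrite ler_wpM2r ?enorm_ge0// lerDl.
rewrite mulr_suml ler_sum// => i _; rewrite mxE mulr_suml.
apply: le_trans (ler_norm_sum _ _ _) _; rewrite ler_sum// => j _.
by rewrite normrM ler_wpM2l ?coord_le_enorm.
Qed.

Lemma enorm_gt0 (R : realType) (d : nat) (x : 'cV[R]_d) : x != 0 -> 0 < enorm x.
Proof.
rewrite lt_def enorm_ge0 andbT; apply: contra_neq => x0.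
apply/colP => i; rewrite mxE; apply/eqP; rewrite -normr_le0 -x0.
exact: coord_le_enorm.
Qed.

Lemma enorm_cvg0 (R : realType) (d : nat) (y : R -> 'cV[R]_d) (eps : R) :
  y t @[t --> +oo] --> (0 : 'cV[R]_d) -> 0 < eps ->
  \forall t \near +oo, enorm (y t) <= eps.
Proof.
move=> /cvgr0Pnorm_lt y0 eps0.
have e0 : 0 < eps / d.+1%:R by rewrite divr_gt0.
near=> t; apply: le_trans (enorm_le_sum _) _.
apply: le_trans (_ : \sum_(i < d) (eps / d.+1%:R) <= _); last first.
  rewrite sumr_const -[_ *+ #|_|]mulr_natr card_ord mulrAC ler_pdivrMr//.
  by rewrite ler_pM2l// ler_nat.
apply: ler_sum => i _; apply: le_trans (_ : `|y t| <= _).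
  rewrite [leRHS]/Num.Def.normr/= mx_normrE.
  exact: (le_bigmax _ (fun ij => `|y t ij.1 ij.2|) (i, ord0)).
by apply/ltW; near: t; exact: y0.
Unshelve. all: by end_near. Qed.

Lemma expO_enorm (R : realType) (a : R) (d : nat) (f : R -> 'cV[R]_d) :
  (forall i, expO a (fun t => f t i ord0)) -> expO a (fun t => enorm (f t)).
Proof.
move=> fO; apply: (@expO_le_near _ _ 1 _ (fun t => \sum_(i < d) `|f t i ord0|)).
  near=> t; rewrite mul1r ger0_norm ?enorm_ge0// ger0_norm ?sumr_ge0//.
  exact: enorm_le_sum.
apply: expO_sum => i; apply: (expO_le_near _ (fO i)).
by near=> t; rewrite normr_id -[leLHS]mul1r.
Unshelve. all: by end_near. Qed.

Lemma is_derive_enorm_sqr (R : realType) (d : nat) (y : R -> 'cV[R]_d)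
    (y' : 'I_d -> R) (t : R) :
  (forall i, is_derive t 1 (fun s => y s i ord0) (y' i)) ->
  is_derive t 1 (fun s => enorm (y s) ^+ 2)
    (\sum_(i < d) 2 * y t i ord0 * y' i).
Proof.
move=> dy.
have -> : (fun s => enorm (y s) ^+ 2) =
    \sum_(i < d) (fun s => y s i ord0) ^+ 2.
  apply/funext => s; rewrite enorm_sqr fct_sumE.
  by apply: eq_bigr => i _; rewrite expr2.
exact: is_derive_sum.
Qed.

(** Gronwall backwards: the derivative of N = |y|^2 is at least - k N, so that
    N e^(k t) is nondecreasing and stays above its positive value at [t0]. *)
Lemma enorm_lower_bound (R : realType) (d : nat) (y : R -> 'cV[R]_d)
    (y' : R -> 'I_d -> R) (a K : R) :
  (forall t i, a < t -> is_derive t 1 (fun s => y s i ord0) (y' t i)) ->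
  (forall t i, a < t -> `|y' t i| <= K * enorm (y t)) ->
  forall t0, a < t0 -> y t0 != 0 ->
  exists c r, 0 < c /\ forall t, t0 <= t -> c * expR (- r * t) <= enorm (y t).
Proof.
move=> dy y'K t0 at0 yt0.
pose k := 2 * d%:R * K.
pose N t := enorm (y t) ^+ 2.
have dN t : a < t -> is_derive t 1 N (\sum_(i < d) 2 * y t i ord0 * y' t i).
  by move=> ta; apply: is_derive_enorm_sqr => i; exact: dy.
have N'k t : a < t -> - k * N t <= \sum_(i < d) 2 * y t i ord0 * y' t i.
  move=> ta; rewrite mulNr lerNl -sumrN.
  rewrite (_ : k * N t = \sum_(i < d) 2 * (enorm (y t) * (K * enorm (y t)))).
    apply: ler_sum => i _; apply: le_trans (ler_norm _) _.
    rewrite normrN -mulrA normrM ger0_norm// ler_pM2l// normrM.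
    by rewrite ler_pM ?coord_le_enorm ?y'K.
  by rewrite sumr_const card_ord -mulr_natr /k /N; ring.
have mono := @is_derive_ge0_homo _ (fun t => N t * expR (k * t)) _ a
  (fun t ta => is_derive_mul_expR k (dN t ta)).
have {}mono t : t0 <= t -> N t0 * expR (k * t0) <= N t * expR (k * t).
  move=> t0t; apply: mono => // u au; rewrite mulr_ge0 ?expR_ge0//.
  by rewrite -lerBlDr sub0r -mulNr N'k.
exists (enorm (y t0) * expR (k / 2 * t0)), (k / 2); split.
  by rewrite mulr_gt0 ?expR_gt0 ?enorm_gt0.
move=> t t0t; rewrite -ler_pdivlMr ?expR_gt0// -expRN.
rewrite -(ler_pXn2r (ltn0Sn 1)) ?nnegrE ?mulr_ge0 ?enorm_ge0 ?expR_ge0//.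
rewrite !exprMn -!expRM_natl -/(N _) -/(N _).
by have := mono _ t0t; congr (_ <= _); congr (_ * expR _); field.
Qed.

(** For N = |z|^2 the linear part contributes at most - 2 m N to N'.  The
    constant m / (2 d) is chosen so that the d terms coming from [G] add up to
    at most m N, which leaves N' <= - m N. *)
Lemma enorm_upper_bound (R : realType) (d : nat) (d_gt0 : (0 < d)%N)
    (z : R -> 'cV[R]_d) (lam : 'I_d -> R) (G : R -> 'I_d -> R) (m : R) :
  (forall i, m <= lam i) ->
  (\forall t \near +oo, forall i,
    is_derive (t : R) 1 (fun s => z s i ord0) (- lam i * z t i ord0 + G t i)) ->
  (\forall t \near +oo, forall i, `|G t i| <= m / (2 * d%:R) * enorm (z t)) ->
  expO (m / 2) (fun t => enorm (z t)).
Proof.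
move=> mlam [T1 [_ dz]] [T2 [_ GK]].
pose T := Num.max T1 T2.
have T1T t : T < t -> T1 < t by apply: le_lt_trans; rewrite le_max lexx.
have T2T t : T < t -> T2 < t by apply: le_lt_trans; rewrite le_max lexx orbT.
pose N t := enorm (z t) ^+ 2.
pose N' t := \sum_(i < d) 2 * z t i ord0 * (- lam i * z t i ord0 + G t i).
have dN t : T < t -> is_derive t 1 N (N' t).
  by move=> /T1T Tt; apply: is_derive_enorm_sqr => i; exact: dz.
have d0 : (d%:R : R) != 0 by rewrite pnatr_eq0 -lt0n.
have N'm t : T < t -> N' t + m * N t <= 0.
  move=> /T2T Tt.
  apply: le_trans (_ : - 2 * m * N t + \sum_(i < d)
      (2 * (enorm (z t) * (m / (2 * d%:R) * enorm (z t)))) + m * N t <= _).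
    rewrite lerD2r /N enorm_sqr mulr_sumr -big_split/=; apply: ler_sum => i _.
    rewrite mulrDr lerD//.
      have -> : 2 * z t i ord0 * (- lam i * z t i ord0) =
          - 2 * lam i * z t i ord0 ^+ 2 by ring.
      by rewrite ler_wpM2r ?sqr_ge0// !mulNr lerN2 ler_pM2l.
    apply: le_trans (ler_norm _) _.
    rewrite -mulrA normrM ger0_norm// ler_pM2l// normrM.
    by rewrite ler_pM ?coord_le_enorm ?GK.
  rewrite sumr_const card_ord -mulr_natr /N.
  by rewrite le_eqVlt; apply/orP; left; apply/eqP; field.
have mono := @is_derive_le0_homo _ (fun t => N t * expR (m * t)) _ T
  (fun t ta => is_derive_mul_expR m (dN t ta)).
pose s := T + 1; have Ts : T < s by rewrite ltrDl.
have {}mono t : s <= t -> N t * expR (m * t) <= N s * expR (m * s).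
  move=> st; apply: mono => // u au; rewrite mulr_le0_ge0 ?expR_ge0//.
  exact: N'm.
apply: (@expO_near _ _ (enorm (z s) * expR (m / 2 * s))); exists s.
split; first exact: num_real.
move=> t /ltW st; rewrite ger0_norm ?enorm_ge0//.
rewrite mulNr expRN ler_pdivlMr ?expR_gt0//.
rewrite -(ler_pXn2r (ltn0Sn 1)) ?nnegrE ?mulr_ge0 ?enorm_ge0 ?expR_ge0//.
rewrite !exprMn -!expRM_natl -/(N _) -/(N _).
by have := mono _ st; congr (_ * expR _ <= _ * expR _); field.
Qed.

(** * Extracting the leading mode of a diagonal system *)

(** [xi] is supported on the coordinates of rate [l]: it is an eigenvector of
    the diagonal matrix with entries [lam]. *)
Definition has_leading_mode (R : realType) (d : nat) (lam : 'I_d -> R)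
    (z : R -> 'cV[R]_d) : Prop :=
  exists (l : R) (xi : 'cV[R]_d),
    [/\ xi != 0, (forall i, xi i ord0 != 0 -> lam i = l) &
      exists delta, 0 < delta /\
        expO (l + delta) (fun t => enorm (z t - expR (- l * t) *: xi))].

Lemma expO_uniform_gap (R : realType) (d : nat) (l : R) (f : 'I_d -> R -> R) :
  (forall i, exists2 delta, 0 < delta & expO (l + delta) (f i)) ->
  exists2 delta, 0 < delta & forall i, expO (l + delta) (f i).
Proof.
move=> gap; have /choice[D Df] i : exists D, 0 < D /\ expO (l + D) (f i).
  by have [D] := gap i; exists D.
exists (\big[Num.min/1]_i D i).
  by apply: lt_bigmin => // i _; case: (Df i).
move=> i; have [_] := Df i; apply: expO_weaken.
by rewrite lerD2l bigmin_le_cond.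
Qed.

(** The dichotomy of the bootstrap.  A mode x_i e^(-lam_i t) with lam_i >= b
    disappears in the error term; so either all modes do, or the slowest
    nonzero ones, of common rate l < b, form the leading term.  The gap is then
    limited by b - l and by the differences between l and the rates of the
    remaining nonzero modes. *)
Lemma leading_mode_of_modes (R : realType) (d : nat) (lam : 'I_d -> R)
    (z : R -> 'cV[R]_d) (x : 'I_d -> R) (b : R) :
  (forall i, expO b (fun t => z t i ord0 - x i * expR (- lam i * t))) ->
  has_leading_mode lam z \/ expO b (fun t => enorm (z t)).
Proof.
move=> zx.
have [[i0 xi0 lb]|no_mode] :=
    pselect (exists2 i, x i != 0 & lam i < b); last first.
  right; apply: expO_enorm => i.
  rewrite (_ : (fun t => _) = fun t => (z t i ord0 - x i * expR (- lam i * t)) +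
      x i * expR (- lam i * t)); last by apply/funext => t; rewrite subrK.
  apply: expOD => //; have [x0|x0] := eqVneq (x i) 0.
    by apply: expO0 => t; rewrite x0 mul0r.
  by apply: expO_expR; rewrite leNgt; apply/negP => lib;
    apply: no_mode; exists i.
left.
have [i1 xi1 lmin] : exists2 i1, x i1 != 0 &
    forall i, x i != 0 -> lam i1 <= lam i.
  by have [i1 ? ?] := @arg_minP _ _ _ i0 (fun i => x i != 0) lam xi0; exists i1.
pose xi : 'cV[R]_d := \col_i (if lam i == lam i1 then x i else 0).
exists (lam i1), xi; split.
- by apply: contra_neq xi1 => /colP/(_ i1); rewrite !mxE eqxx.
- by move=> i; rewrite mxE; case: (lam i =P lam i1) => // _; rewrite eqxx.
have l1b : lam i1 < b by exact: le_lt_trans (lmin _ xi0) lb.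
suff [delta d0 zO] : exists2 delta, 0 < delta &
    forall i, expO (lam i1 + delta)
      (fun t => (z t - expR (- lam i1 * t) *: xi) i ord0).
  by exists delta; split => //; exact: expO_enorm.
apply: expO_uniform_gap => i.
have [li|li] := eqVneq (lam i) (lam i1).
  exists (b - lam i1); first by rewrite subr_gt0.
  rewrite addrC subrK; move: (zx i); congr expO.
  by apply/funext => t; rewrite !mxE li eqxx mulrC.
have zE : (fun t => (z t - expR (- lam i1 * t) *: xi) i ord0) =
    fun t => (z t i ord0 - x i * expR (- lam i * t)) + x i * expR (- lam i * t).
  by apply/funext => t; rewrite !mxE (negPf li) mulr0 subr0 subrK.
have [x0|x0] := eqVneq (x i) 0.
  exists (b - lam i1); first by rewrite subr_gt0.
  rewrite addrC subrK zE; apply: expOD => //.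
  by apply: expO0 => t; rewrite x0 mul0r.
have lt1 : lam i1 < lam i by rewrite lt_def li lmin.
exists (Num.min (b - lam i1) (lam i - lam i1)).
  by rewrite lt_min !subr_gt0 l1b lt1.
rewrite zE; apply: expOD.
  by apply: expO_weaken (zx i); rewrite -lerBrDl ge_min lexx.
by apply: expO_expR; rewrite -lerBrDl ge_min lexx orbT.
Qed.

Lemma expO_powR (R : realType) (a p : R) (f : R -> R) : 0 <= p ->
  (forall t, 0 <= f t) -> expO a f -> expO (p * a) (fun t => f t `^ p).
Proof.
move=> p0 f0 [T [C [C0 fC]]].
apply: (@expO_near _ _ (C `^ p)); exists T; split; first exact: num_real.
move=> t /ltW Tt; rewrite ger0_norm ?powR_ge0//.
rewrite (_ : - (p * a) * t = (- a * t) * p); last by ring.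
rewrite expRM -powRM ?expR_ge0 ?(ltW C0)//.
rewrite ge0_ler_powR ?nnegrE ?f0 ?mulr_ge0 ?expR_ge0 ?(ltW C0)//.
by have := fC _ Tt; rewrite ger0_norm.
Qed.

(** If a > r, then e^((a - r) t) >= 1 + (a - r) t exceeds every constant, and
    the two bounds contradict each other at a late time. *)
Lemma expO_lower_bound (R : realType) (a c r : R) (f : R -> R) : 0 < c ->
  (\forall t \near +oo, c * expR (- r * t) <= `|f t|) -> expO a f -> a <= r.
Proof.
move=> c0 [T [_ fc]] /(expO_after T)[S [C [TS S0 C0 fC]]].
rewrite leNgt; apply/negP => ra; have k0 : 0 < a - r by rewrite subr_gt0.
pose t := S + C / (c * (a - r)).
have q0 : 0 < C / (c * (a - r)) by rewrite divr_gt0// mulr_gt0.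
have St : S < t by rewrite ltrDl.
have := le_trans (fc t (lt_trans TS St)) (fC t St).
rewrite leNgt => /negP; apply.
rewrite (_ : - r * t = (a - r) * t + - a * t); last by ring.
rewrite expRD mulrA ltr_pM2r ?expR_gt0//.
rewrite mulrC -ltr_pdivrMr//; apply: lt_le_trans (expR_ge1Dx _).
rewrite (_ : C / c = (a - r) * (C / (c * (a - r)))); last first.
  by field; rewrite !lt0r_neq0.
rewrite ltr_pwDl// ler_pM2l//; rewrite /t; lra.
Qed.

(** Assuming that there is no leading mode, each pass through
    [leading_mode_of_modes] improves the rate by the factor 1 + alpha / 2; the
    rates are then unbounded, against [expO_lower_bound]. *)
Lemma diagonal_leading_mode (R : realType) (d : nat) (d_gt0 : (0 < d)%N)
    (lam : 'I_d -> R) (z : R -> 'cV[R]_d) (G : R -> 'I_d -> R)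
    (C alpha c r : R) :
  (forall i, 0 < lam i) -> 0 < alpha -> 0 < c ->
  (\forall t \near +oo, forall i,
    is_derive (t : R) 1 (fun s => z s i ord0) (- lam i * z t i ord0 + G t i)) ->
  (\forall t \near +oo, forall i, `|G t i| <= C * enorm (z t) `^ (1 + alpha)) ->
  (forall eps, 0 < eps -> \forall t \near +oo, enorm (z t) <= eps) ->
  (\forall t \near +oo, c * expR (- r * t) <= enorm (z t)) ->
  has_leading_mode lam z.
Proof.
move=> lam0 alpha0 c0 dz GC z_small z_large.
have alpha1 : 0 <= 1 + alpha by rewrite addr_ge0// ltW.
have [//|no_mode] := pselect (has_leading_mode lam z).
have step a : 0 < a -> expO a (fun t => enorm (z t)) ->
    expO ((1 + alpha / 2) * a) (fun t => enorm (z t)).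
  move=> a0 za.
  have GO i : expO ((1 + alpha) * a) (fun t => G t i).
    apply: (@expO_le_near _ _ C _ (fun t => enorm (z t) `^ (1 + alpha))).
      near=> t; rewrite [X in _ * X]ger0_norm ?powR_ge0//.
      by move: i; near: t; exact: GC.
    by apply: expO_powR => // t; exact: enorm_ge0.
  have lt_rate : (1 + alpha / 2) * a < (1 + alpha) * a.
    by rewrite ltr_pM2r//; lra.
  have /choice[x zx] i : exists x, expO ((1 + alpha / 2) * a)
      (fun t => z t i ord0 - x * expR (- lam i * t)).
    have [T [_ dzT]] := dz.
    have [x xO] := scalar_asymptotics lt_rate (fun t Tt => dzT t Tt i) (GO i).
    by exists x.
  by have [] := leading_mode_of_modes zx.
have [m m0 mlam] : exists2 m, 0 < m & forall i, m <= lam i.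
  exists (\big[Num.min/1]_i lam i); first exact: lt_bigmin.
  by move=> i; rewrite bigmin_le_cond.
have base : expO (m / 2) (fun t => enorm (z t)).
  apply: (enorm_upper_bound d_gt0 mlam dz).
  (* [eta] is the bound on |z|^alpha which makes K |z|^(1 + alpha) at most
     m / (2 d) |z|. *)
  pose K := `|C| + 1.
  have K0 : 0 < K by rewrite ltr_wpDl.
  pose eta := m / (2 * d%:R) / K.
  have eta0 : 0 < eta by rewrite !divr_gt0// mulr_gt0// ltr0n.
  have {}z_small := z_small (eta `^ alpha^-1) (powR_gt0 _ eta0).
  near=> t => i; apply: (@le_trans _ _ (C * enorm (z t) `^ (1 + alpha))).
    by move: i; near: t; exact: GC.
  apply: (@le_trans _ _ (K * enorm (z t) `^ (1 + alpha))).
    by rewrite ler_wpM2r ?powR_ge0// ler_wpDr// ler_norm.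
  rewrite powRD; last by rewrite gt_eqF// ltr_wpDr// ltW.
  rewrite powRr1 ?enorm_ge0// mulrCA mulrC ler_wpM2r ?enorm_ge0//.
  rewrite mulrC -ler_pdivlMr// -/eta.
  rewrite -[leRHS](powRr1 (ltW eta0)) -(mulVf (lt0r_neq0 alpha0)) powRrM.
  rewrite ge0_ler_powR ?nnegrE ?enorm_ge0 ?powR_ge0 ?(ltW alpha0)//.
  by near: t.
pose q := 1 + alpha / 2.
have rate n : expO (q ^+ n * (m / 2)) (fun t => enorm (z t)).
  elim: n => [|n IHn]; first by rewrite mul1r.
  rewrite exprS -mulrA; apply: step => //.
  by rewrite mulr_gt0 ?exprn_gt0 ?divr_gt0// /q; lra.
have rate_le n : q ^+ n * (m / 2) <= r.
  apply: (expO_lower_bound c0 _ (rate n)).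
  by near=> t; rewrite ger0_norm ?enorm_ge0//; near: t.
have bern n : 1 + n%:R * (alpha / 2) <= q ^+ n.
  elim: n => [|n IHn]; first by rewrite mul0r addr0.
  rewrite exprS; apply: le_trans (ler_wpM2l _ IHn); last by rewrite /q; lra.
  rewrite -natr1 /q mulrDl mulrDr mulr1 !mulrDl.
  have : 0 <= alpha / 2 * (n%:R * (alpha / 2)).
    by rewrite !mulr_ge0// ?divr_ge0// ltW.
  lra.
have [n _ rn] : exists2 n, True & r / (m / 2) / (alpha / 2) < n%:R.
  exists (Num.bound `|r / (m / 2) / (alpha / 2)|) => //.
  exact: le_lt_trans (ler_norm _) (archi_boundP (normr_ge0 _)).
have := rate_le n; rewrite -ler_pdivlMr ?divr_gt0//.
move: rn; rewrite ltr_pdivrMr ?divr_gt0// => rn /(le_trans (bern n)); lra.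
Unshelve. all: by end_near. Qed.

(** * Solutions on the half-line *)

(** At a positive time the constraint s >= 0 holds near [t], so that the
    one-sided quotient has the same limit as the two-sided one. *)
Lemma halfline_is_derive (R : realType) (d : nat) (y : R -> 'cV[R]_d) (t : R)
    (l : 'cV[R]_d) : 0 < t ->
  (s - t)^-1 *: (y s - y t) @[s --> within [set s : R | 0 <= s] t^'] --> l ->
  is_derive t 1 y l.
Proof.
move=> t0 yl.
suff yl0 : h^-1 *: ((y \o shift t) (h *: 1) - y t) @[h --> 0^'] --> l.
  by apply: DeriveDef; [apply/cvg_ex; exists l|exact: cvg_lim].
move: yl => /cvgrPdist_lt yl; apply/cvgrPdist_lt => e e0.
have [r /= r0 yr] := yl _ e0.
exists (Num.min r t); first by rewrite /= lt_min r0.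
move=> h /=; rewrite sub0r normrN lt_min => /andP[hr ht] h0.
have := yr (h + t); rewrite addrK /shift/= /GRing.scale/= mulr1; apply.
- by rewrite opprD addrCA subrr addr0 normrN.
- by rewrite -subr_eq0 addrK.
- by move: ht; rewrite ltr_norml => /andP[]; lra.
Qed.

(** The derivative at 0 is one-sided, so that the estimates below only use
    times t > 0; this provides one of them where [y] does not vanish.  If there
    were none, s times the difference quotient would tend both to 0 and to
    - y 0. *)
Lemma halfline_neq0_right (R : realType) (d : nat) (y : R -> 'cV[R]_d)
    (l : 'cV[R]_d) : y 0 != 0 ->
  (s - 0)^-1 *: (y s - y 0) @[s --> within [set s : R | 0 <= s] 0^'] --> l ->
  exists2 t, 0 < t & y t != 0.
Proof.
move=> y0 yl; apply: contrapT => noy.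
have y_0 t : 0 < t -> y t = 0.
  by move=> t0; apply: contrapT => /eqP yt; apply: noy; exists t.
have sub : (0 : R)^'+ `=>` within [set s : R | 0 <= s] 0^'.
  move=> A [e /= e0 eA]; exists e => //= s se s0; apply: eA => //=.
    by rewrite gt_eqF.
  exact: ltW.
have lim1 : s *: ((s - 0)^-1 *: (y s - y 0)) @[s --> (0 : R)^'+] --> 0 *: l.
  apply: cvgZ; last exact: cvg_trans (cvg_app _ sub) yl.
  exact/cvg_at_right_filter/cvg_id.
have lim2 : s *: ((s - 0)^-1 *: (y s - y 0)) @[s --> (0 : R)^'+] --> - y 0.
  apply: cvg_near_cst; near=> s.
  by rewrite subr0 y_0// sub0r scalerA divff ?scale1r// gt_eqF.
have /esym/eqP : 0 *: l = - y 0 by apply: norm_cvg_unique lim1 lim2.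
by rewrite scale0r oppr_eq0 (negPf y0).
Unshelve. all: by end_near. Qed.

Lemma is_derive_coord (R : realType) (d : nat) (y : R -> 'cV[R]_d) (t : R)
    (l : 'cV[R]_d) (i : 'I_d) :
  is_derive t 1 y l -> is_derive t 1 (fun s => y s i ord0) (l i ord0).
Proof.
move=> [dy yl]; apply: DeriveDef; first by have /derivable_mxP := dy; apply.
by rewrite -yl derive_mx// mxE.
Qed.

Lemma is_derive_mulmx (R : realType) (m n : nat) (M : 'M[R]_(m, n))
    (y : R -> 'cV[R]_n) (t : R) (l : 'cV[R]_n) (i : 'I_m) :
  is_derive t 1 y l ->
  is_derive t 1 (fun s => (M *m y s) i ord0) ((M *m l) i ord0).
Proof.
move=> dy.
rewrite (_ : (fun s => _) = \sum_(j < n) (M i j *: (fun s => y s j ord0))).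
  rewrite mxE; apply: is_derive_sum => j; apply: is_deriveZ.
  exact: is_derive_coord.
by apply/funext => s; rewrite mxE fct_sumE.
Qed.

(** A global linear bound on the derivative, from one that holds only where
    [y] is small: the times where [y] is large lie in a compact interval, on
    which [g] is bounded by some M, and there M <= (M / eps) |y|. *)
Lemma derivative_le_enorm (R : realType) (d : nat) (y g : R -> 'cV[R]_d)
    (eps K T : R) : 0 < eps ->
  {within [set t : R | 0 <= t], continuous g} ->
  (forall t, T < t -> enorm (y t) <= eps) ->
  (forall t, 0 < t -> enorm (y t) <= eps ->
    forall i, `|g t i ord0| <= K * enorm (y t)) ->
  exists K', forall t i, 0 < t -> `|g t i ord0| <= K' * enorm (y t).
Proof.
move=> eps0 gc yT gK.
have gnc : {within `[0, Num.max 0 T], continuous (fun t => `|g t|)}.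
  have /continuous_subspaceW :
      {within [set t : R | 0 <= t], continuous (fun t => `|g t|)}.
    move=> t; apply: (continuous_comp (gc t)); exact: norm_continuous.
  by apply => t /=; rewrite in_itv/= => /andP[].
have [|m _ gm] := EVT_max _ gnc; first by rewrite le_max lexx.
exists (Num.max K (`|g m| / eps)) => t i t0.
have [ye|ye] := leP (enorm (y t)) eps.
  apply: le_trans (gK _ t0 ye i) _.
  by rewrite ler_wpM2r ?enorm_ge0// le_max lexx.
apply: (@le_trans _ _ `|g t|).
  rewrite [leRHS]/Num.Def.normr/= mx_normrE.
  exact: (le_bigmax _ (fun ij => `|g t ij.1 ij.2|) (i, ord0)).
apply: (@le_trans _ _ `|g m|).
  apply: gm; rewrite in_itv/= (ltW t0)/= le_max; apply/orP; right.
  by rewrite leNgt; apply/negP => /yT; rewrite leNgt ye.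
apply: (@le_trans _ _ (`|g m| / eps * enorm (y t))).
  by rewrite mulrAC ler_pdivlMr// ler_wpM2l// ltW.
by rewrite ler_wpM2r ?enorm_ge0// le_max lexx orbT.
Qed.

(** * Decay along an eigenvector *)

Theorem theorem3p3 (R : realType) (d : nat) (d_gt0 : (0 < d)%N) (A : 'M[R]_d)
    (A_diag : diagonalizable A)
    (A_pos : forall a : R, eigenvalue A a -> 0 < a)
    (F : R -> 'cV[R]_d -> 'cV[R]_d)
    (F_cont : continuous_on_halfline F)
    (F_lip : locally_lipschitz_in_x F)
    (F_small : exists c eps alpha : R, [/\ 0 < c, 0 < eps, 0 < alpha &
       forall (t : R) (x : 'cV[R]_d), 0 <= t -> enorm x <= eps ->
         enorm (F t x) <= c * enorm x `^ (1 + alpha)])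
    (y : R -> 'cV[R]_d)
    (y_C1 : C1_halfline y)
    (y_sol : forall t : R, 0 < t -> derive1 y t + A *m y t = F t (y t))
    (y0_neq0 : y 0 <> 0)
    (y_lim : y t @[t --> +oo] --> (0 : 'cV[R]_d)) :
  exists (lambda : R) (xi : 'cV[R]_d),
    [/\ eigenvalue A lambda, is_eigenvector A lambda xi &
      exists delta : R, 0 < delta /\
        bigO_pinfty (fun t => enorm (y t - expR (- lambda * t) *: xi))
                    (fun t => expR (- (lambda + delta) * t))].
Proof.
have [P Pu /similar_diagPex[D /(similarP Pu) PA]] := A_diag.
have [c [eps [alpha [c0 eps0 alpha0 Fc]]]] := F_small.
have [g [gc yg]] := y_C1.
have dy (t : R) : 0 < t -> is_derive t 1 y (g t).
  by move=> t0; apply: halfline_is_derive => //; apply: yg; exact: ltW.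
have gE t : 0 < t -> g t = F t (y t) - A *m y t.
  move=> t0; rewrite -y_sol// addrK derive1E.
  by have [_ ->] := dy _ t0.
pose lam i := D ord0 i.
(* The rows of [P] are the left eigenvectors, those of [eigenvalue]; the columns
   of its inverse are the right ones. *)
have lam_ev i : eigenvalue A (lam i).
  apply/eigenvalueP; exists (row i P).
    rewrite -row_mul PA; apply/rowP => j.
    by rewrite mxE mul_diag_mx !mxE.
  apply/eqP => Pi0; have := congr1 (mulmx^~ (invmx P)) Pi0.
  rewrite rowE mulmxK// mul0mx => /rowP/(_ i)/eqP.
  by rewrite !mxE !eqxx oner_eq0.
have [CA CA0 CAP] := enorm_mulmx A.
have [CP CP0 CPP] := enorm_mulmx P.
have [CQ CQ0 CQP] := enorm_mulmx (invmx P).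
pose z t := P *m y t.
have yz t : y t = invmx P *m z t by rewrite /z mulKmx.
have y_small := enorm_cvg0 y_lim.
have [t0 t0_gt0 yt0] : exists2 t, 0 < t & y t != 0.
  by apply: halfline_neq0_right (yg 0 (lexx 0)); exact/eqP.
have [c1 [r [c1_gt0 y_low]]] : exists c r, 0 < c /\
    forall t, t0 <= t -> c * expR (- r * t) <= enorm (y t).
  have [T [_ yT]] := y_small _ eps0.
  have gK t : 0 < t -> enorm (y t) <= eps ->
      forall i, `|g t i ord0| <= (c * eps `^ alpha + CA) * enorm (y t).
    move=> tp ye i; rewrite gE// mxE [X in _ + X]mxE mulrDl.
    apply: le_trans (ler_normB _ _) _; apply: lerD; last first.
      exact: le_trans (coord_le_enorm _ _) (CAP _).
    apply: le_trans (coord_le_enorm _ _) _.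
    apply: le_trans (Fc _ _ (ltW tp) ye) _.
    rewrite -mulrA ler_pM2l// powRD; last by rewrite gt_eqF// ltr_wpDr// ltW.
    rewrite powRr1 ?enorm_ge0// mulrC ler_wpM2r ?enorm_ge0//.
    by rewrite ge0_ler_powR ?nnegrE ?enorm_ge0 ?(ltW alpha0) ?(ltW eps0).
  have [K gyK] := derivative_le_enorm eps0 gc yT gK.
  apply: (enorm_lower_bound (y' := fun t i => g t i ord0) _ gyK t0_gt0 yt0).
  by move=> t i tp; apply: is_derive_coord; exact: dy.
have [l [xi [xi0 xil [delta [delta0 zO]]]]] : has_leading_mode lam z.
  pose G t i := (P *m F t (y t)) i ord0.
  pose C := CP * (c * CQ `^ (1 + alpha)).
  apply: (@diagonal_leading_mode _ _ d_gt0 _ _ G C alpha (c1 / CQ) r) => //.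
  - by move=> i; exact: A_pos.
  - by rewrite divr_gt0.
  - near=> t => i; have tp : 0 < t by [].
    rewrite (_ : _ + _ = (P *m g t) i ord0); first exact/is_derive_mulmx/dy.
    rewrite gE// mulmxBr mulmxA PA -mulmxA [RHS]mxE addrC; congr (_ + _).
    by rewrite [RHS]mxE mul_diag_mx [in RHS]mxE mulNr.
  - have ye := y_small _ eps0.
    near=> t => i; have tp : 0 <= t by [].
    apply: le_trans (coord_le_enorm _ _) _; apply: le_trans (CPP _) _.
    rewrite /C -mulrA ler_pM2l// -mulrA.
    apply: (le_trans (Fc _ _ tp _)); first by near: t.
    rewrite ler_pM2l// -powRM ?enorm_ge0 ?(ltW CQ0)//.
    rewrite ge0_ler_powR ?nnegrE ?mulr_ge0 ?enorm_ge0 ?(ltW CQ0)//.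
      by rewrite addr_ge0// ltW.
    by rewrite yz CQP.
  - move=> e e0; have ye := y_small (e / CP) (divr_gt0 e0 CP0).
    near=> t; apply: le_trans (CPP _) _; rewrite mulrC -ler_pdivlMr//.
    by near: t.
  - near=> t; rewrite mulrAC ler_pdivrMr// [leRHS]mulrC.
    by apply: le_trans (CQP _); rewrite -yz y_low.
have [i xi_i] : exists i, xi i ord0 != 0.
  apply: contrapT => noxi; move/eqP: xi0; apply; apply/colP => i.
  by rewrite mxE; apply: contrapT => /eqP xi_i; apply: noxi; exists i.
exists l, (invmx P *m xi); split.
- by rewrite -(xil _ xi_i).
- split.
    move=> /(congr1 (mulmx P)); rewrite mulKVmx// mulmx0.
    exact/eqP.
  have -> : A = invmx P *m (diag_mx D *m P) by rewrite -PA mulKmx.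
  rewrite -!mulmxA mulKVmx// scalemxAr; congr (_ *m _).
  apply/colP => j; rewrite mul_diag_mx !mxE.
  have [->|/xil <-//] := eqVneq (xi j ord0) 0.
  by rewrite !mulr0.
exists delta; split => //.
apply: (@expO_le_near _ _ CQ _ _ _ zO).
near=> t; rewrite !ger0_norm ?enorm_ge0//.
by rewrite yz scalemxAr -mulmxBr.
Unshelve. all: end_near.
Qed.
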